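(* Consider the FDCMSS sketch described in the context, built with parameters $0<\epsilon<1$ and $0<\delta<1$ (so $d=\lceil \ln(1/\delta)\rceil$ rows and $w=\lceil e/(2\epsilon)\rceil$ columns), after processing a stream $\sigma$ of items from $[m]=\{1,\dots,m\}$, and queried at time $t$. For every item $k\in[m]$, let $f_k$ be its exact (normalized) forward-decayed count at time $t$ and $\hat f_k$ the estimate returned by the point query for $k$. Then $\hat f_k$ estimates $f_k$ with error less than $\epsilon C$ with probability greater than $1-\delta$, i.e. $\Pr[\hat f_k - f_k < \epsilon C] > 1-\delta$, where $C$ is the total decayed count of the stream at time $t$.
   Context: Forward decay: fix a positive monotone non-decreasing function $g$ and a landmark time $L$ with $L<t_i$ for every stream element's timestamp $t_i$. The stream $\sigma$ is a sequence of $n$ elements $(v_1,t_1),\dots,(v_n,t_n)$ with $v_i\in[m]$. At query time $t\ge t_i$ for all $i$, the decayed count of item $v$ is $f_v=\sum_{i: v_i=v} g(t_i-L)/g(t-L)$ and the total decayed count is $C=\sum_{i=1}^n g(t_i-L)/g(t-L)$. Weighted Space Saving with two counters: a summary $\mathcal S$ consists of two counters, each storing an item and a nonnegative value (initially no item, value $0$). To update $\mathcal S$ with item $j$ and weight $x>0$: if $j$ is monitored by a counter, add $x$ to its value; else if some counter monitors no item, assign $j$ to it and set its value to $x$; else take the counter with smallest value, replace its item by $j$ and add $x$ to its value. FDCMSS sketch: a $d\times w$ array $D$ whose every cell holds a two-counter Space Saving summary; hash functions $h_1,\dots,h_d:[m]\to[w]$ are chosen independently of one another, each from a pairwise independent family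 (so $\Pr[h_i(k)=j]=1/w$). Processing element $(v,t_v)$: compute $x=g(t_v-L)$ and, for each row $r=1,\dots,d$, perform the weighted Space Saving update of cell $D[r][h_r(v)]$ with item $v$ and weight $x$. Point query for item $k$ at time $t$: for each row $r$, let the cell value be the value of the counter in $D[r][h_r(k)]$ monitoring $k$ if one exists, otherwise the minimum of the two counter values in that cell; return $\hat f_k=\min_r(\text{cell value})/g(t-L)$. *)

(* Defs.v *)
From HB Require Import structures.
From mathcomp Require Import all_boot all_order all_algebra.
From mathcomp Require Import all_classical all_reals all_analysis.

Set Implicit Arguments.
Unset Strict Implicit.
Unset Printing Implicit Defensive.

Import Order.TTheory GRing.Theory Num.Theory.
Local Open Scope classical_set_scope.
Local Open Scope ring_scope.

(* The items [m] = {1, ..., m} are encoded as 'I_m and a stream of timestamped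
   items as a sequence of pairs (v, s). *)

Definition decayed_count (R : realType) (m : nat) (g : R -> R) (L t : R)
    (sigma : seq ('I_m * R)) (k : 'I_m) : R :=
  \sum_(e <- sigma | e.1 == k) g (e.2 - L) / g (t - L).

Definition total_decayed_count (R : realType) (m : nat) (g : R -> R) (L t : R)
    (sigma : seq ('I_m * R)) : R :=
  \sum_(e <- sigma) g (e.2 - L) / g (t - L).

(* Monitored item (None when the counter is free) and value. *)
Definition counter (R : realType) (m : nat) : Type := (option 'I_m * R)%type.

Definition summary (R : realType) (m : nat) : Type :=
  (counter R m * counter R m)%type.

Definition ss_empty (R : realType) (m : nat) : summary R m :=
  ((None, 0), (None, 0)).

(* Space Saving does not say which counter is evicted when the two values are
   equal: an arbitrary rule tie decides (true evicts the first counter). *)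
Definition ss_update (R : realType) (m : nat) (tie : summary R m -> bool)
    (S : summary R m) (j : 'I_m) (x : R) : summary R m :=
  let: (c1, c2) := S in
  if c1.1 == Some j then ((Some j, c1.2 + x), c2)
  else if c2.1 == Some j then (c1, (Some j, c2.2 + x))
  else if c1.1 == None then ((Some j, x), c2)
  else if c2.1 == None then (c1, (Some j, x))
  else if (c1.2 < c2.2) || ((c1.2 == c2.2) && tie S)
  then ((Some j, c1.2 + x), c2)
  else (c1, (Some j, c2.2 + x)).

Definition ss_query (R : realType) (m : nat) (S : summary R m) (k : 'I_m) : R :=
  let: (c1, c2) := S in
  if c1.1 == Some k then c1.2
  else if c2.1 == Some k then c2.2
  else Num.min c1.2 c2.2.

Definition fdcmss_update (R : realType) (m d w : nat)
    (tie : summary R m -> bool) (g : R -> R) (L : R)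
    (h : 'I_d -> {ffun 'I_m -> 'I_w})
    (D : 'M[summary R m]_(d, w)) (e : 'I_m * R) : 'M[summary R m]_(d, w) :=
  \matrix_(r < d, c < w)
    if c == h r e.1 then ss_update tie (D r c) e.1 (g (e.2 - L)) else D r c.

Definition fdcmss (R : realType) (m d w : nat)
    (tie : summary R m -> bool) (g : R -> R) (L : R)
    (h : 'I_d -> {ffun 'I_m -> 'I_w})
    (sigma : seq ('I_m * R)) : 'M[summary R m]_(d, w) :=
  foldl (fdcmss_update tie g L h) (const_mx (ss_empty R m)) sigma.

(* The minimum of a nonempty sequence (0 for the empty one): the initial value
   of the iteration is itself an element of the sequence. *)
Definition seq_min (R : realType) (s : seq R) : R :=
  \big[Num.min/head 0 s]_(x <- s) x.

Definition point_query (R : realType) (m d w : nat) (g : R -> R) (L t : R)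
    (h : 'I_d -> {ffun 'I_m -> 'I_w})
    (D : 'M[summary R m]_(d, w)) (k : 'I_m) : R :=
  seq_min [seq ss_query (D r (h r k)) k | r <- enum 'I_d] / g (t - L).

(* A random hash function on a probability space; drawing uniformly from a
   finite family of functions is a special case. *)
Definition random_hash (disp : measure_display) (T : measurableType disp)
    (m w : nat) (h : T -> {ffun 'I_m -> 'I_w}) : Prop :=
  forall A : set {ffun 'I_m -> 'I_w}, measurable (h @^-1` A).

Definition pairwise_independent_hash (R : realType) (disp : measure_display)
    (T : measurableType disp) (P : probability T R) (m w : nat)
    (h : T -> {ffun 'I_m -> 'I_w}) : Prop :=
  (forall (a : 'I_m) (x : 'I_w), P [set o | h o a = x] = (w%:R^-1)%:E) /\
  (forall (a b : 'I_m) (x y : 'I_w), a != b ->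
     P [set o | h o a = x /\ h o b = y] =
     (P [set o | h o a = x] * P [set o | h o b = y])%E).

(* Mutual independence; subfamilies are covered by taking A r = setT. *)
Definition mutually_independent (R : realType) (disp : measure_display)
    (T : measurableType disp) (P : probability T R) (d m w : nat)
    (h : 'I_d -> T -> {ffun 'I_m -> 'I_w}) : Prop :=
  forall A : 'I_d -> set {ffun 'I_m -> 'I_w},
    P (\bigcap_(r in [set: 'I_d]) (h r @^-1` A r)) =
    (\prod_(r < d) P (h r @^-1` A r))%E.

(* Main.v *)
Require Import Defs.
From HB Require Import structures.
From mathcomp Require Import all_boot all_order all_algebra.
From mathcomp Require Import all_classical all_reals all_analysis.
From mathcomp Require Import ring lra.

(** A query in a Space Saving cell exceeds the true weight of [k] by at most half
    of the weight [X] of the other items of the cell, because the value of a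
    counter monitoring [k] exceeds the weight of [k] by at most the value of the
    other counter.  Since [E X <= C / w], Markov's inequality makes a row fail
    with probability at most [1 / (2 eps w) <= 1 / e], and independence gives
    [e ^- d <= delta] for all the rows together.

    The strict inequality needs more, as [2 eps w = e] and [e ^- d = delta] may
    both hold.  Equality in Markov's inequality forces [X] to be [0] or [C e / w]
    almost surely.  The collision sets with [X = C e / w] then form a 0-1 matrix
    [A] for which [A x = 1] has a real, hence a rational, solution [x], while the
    probabilities [y] of these sets satisfy [y A = (1 / w, ..., 1 / w)].  So
    [1 / e], the sum of [y], is [y A x = (\sum_j x_j) / w], a rational number:
    this contradicts the irrationality of [e]. *)

Set Implicit Arguments.
Unset Strict Implicit.
Unset Printing Implicit Defensive.

Import Order.TTheory GRing.Theory Num.Theory.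
Local Open Scope classical_set_scope.
Local Open Scope ring_scope.

(** * Irrationality of e *)

Lemma series_exp_le_expR1 (R : realType) (n : nat) :
  series (exp_coeff (1 : R)) n <= expR 1.
Proof.
apply: nondecreasing_cvgn_le; last exact: is_cvg_series_exp_coeff.
by apply: nondecreasing_series => i _ _; exact: exp_coeff_ge0.
Qed.

(* The right-hand side is nonincreasing in [n]. *)
Lemma expR1_le_series (R : realType) (n : nat) : (0 < n)%N ->
  expR 1 <= series (exp_coeff (1 : R)) n.+1 + (n`! * n)%:R^-1.
Proof.
move=> n0.
have step k : series (exp_coeff (1 : R)) (k + n).+1 + ((k + n)`! * (k + n))%:R^-1
    <= series (exp_coeff 1) n.+1 + (n`! * n)%:R^-1.
  elim: k => [//|k IH]; apply: le_trans IH.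
  rewrite addSn; move: (k + n)%N (ltn_addl k n0) => j j0.
  rewrite {1}/series/= big_nat_recr//= -/(series _ _) -addrA lerD2l.
  rewrite /exp_coeff/= expr1n factS !natrM -!natr1.
  have jR : 0 < j%:R :> R by rewrite ltr0n.
  have fR : 0 < j`!%:R :> R by rewrite ltr0n fact_gt0.
  have H : ((j`!%:R * j%:R)^-1 : R) -
      (1 / ((j%:R + 1) * j`!%:R) + ((j%:R + 1) * j`!%:R * (j%:R + 1))^-1)
     = (j`!%:R * j%:R * (j%:R + 1) ^+2)^-1.
    field.
    by rewrite !gt_eqF//= addr_gt0.
  rewrite -subr_ge0 H invr_ge0 ltW// !mulr_gt0// ?exprn_gt0// addr_gt0//.
apply: limr_le; first exact: is_cvg_series_exp_coeff.
exists n.+1 => // j /= nj.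
have := step (j - n.+1)%N; rewrite -addnS subnK// => H.
by apply: le_trans H; rewrite lerDl invr_ge0.
Qed.

(** If e were rational with denominator dividing [n!], then [n!] times the gap between e and its
    partial sum would be an integer; the bounds above put it strictly between 0 and 1. *)
Lemma irrational_expR1 (R : realType) : irrational (expR 1 : R).
Proof.
move=> [q _ qe].
(* The successor ensures [1 < n], hence [n^-1 < 1], even for denominator 1. *)
pose n := `|denq q|%N.+1.
have n0 : 0 < n`!%:R :> R by rewrite ltr0n fact_gt0.
have dn : (`|denq q| %| n`!)%N by rewrite dvdn_fact// absz_gt0 denq_neq0/=.
have Z1 : n`!%:R * (expR 1 : R) \is a Num.int.
  rewrite -qe /ratr -(divnK dn) natrM.
  have dE : (`|denq q|%N)%:R = (denq q)%:~R :> R by rewrite pmulrn absz_denq.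
  rewrite dE [X in X \is a _](_ : _ = (n`! %/ `|denq q|)%:R * (numq q)%:~R).
    by rewrite rpredM ?natr_int ?intr_int.
  by field; rewrite intr_eq0 denq_neq0.
have Z2 : n`!%:R * series (exp_coeff (1 : R)) n.+1 \is a Num.int.
  rewrite /series/= mulr_sumr big_mkord; apply: rpred_sum => i _.
  rewrite /exp_coeff/= expr1n mul1r.
  have /dvdnP[c ->] : (i`! %| n`!)%N.
    by rewrite -(bin_fact (leq_ord i)) dvdn_mull// dvdn_mulr.
  by rewrite natrM mulfK ?natr_int// pnatr_eq0 -lt0n fact_gt0.
have := rpredB Z1 Z2; rewrite -mulrBr.
have n0' : (0 < n)%N by [].
have := expR1_le_series R n0'.
(* One term more than in [s] makes the gap [e - s] strictly positive. *)
have := series_exp_le_expR1 R n.+2.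
rewrite {1}/series/= big_nat_recr//= -/(series _ _).
set s := series _ _; set e := expR 1.
have : 0 < exp_coeff (1 : R) n.+1.
  by rewrite /exp_coeff/= expr1n divr_gt0// ltr0n fact_gt0.
move: (exp_coeff _ _) => c c0 h1 h2 h3.
have es : 0 < n`!%:R * (e - s).
  by rewrite mulr_gt0// subr_gt0 (lt_le_trans _ h1)// ltrDl.
have : n`!%:R * (e - s) < 1.
  apply: (@le_lt_trans _ _ (n%:R^-1)).
    by rewrite -ler_pdivlMl// -invfM -natrM lerBlDl.
  by rewrite invf_lt1 ?ltr0n// ltr1n ltnS absz_gt0 denq_neq0.
have := h3; rewrite intrEge0 ?ltW// => /natrP[k] kE.
by rewrite kE in es *; rewrite ltr0n in es; rewrite ltrn1 ltnS leqNgt es.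
Qed.

(** * Strict form of Markov's inequality *)

(* If a rational linear system has a real solution it has a rational one, so the
   pairing of a left and a right real solution is rational. *)
Lemma rational_pairing (R : realType) (p n : nat) (A : 'M[rat]_(p, n))
    (b : 'cV[rat]_p) (c : 'rV[rat]_n) (y : 'rV[R]_p) (x : 'cV[R]_n) :
  map_mx ratr A *m x = map_mx ratr b -> y *m map_mx ratr A = map_mx ratr c ->
  rational ((y *m map_mx ratr b) 0 0).
Proof.
move=> Ax yA.
have : (map_mx (ratr : rat -> R) b^T <= map_mx ratr A^T)%MS.
  by apply/submxP; exists x^T; rewrite -!matrix.map_trmx -trmx_mul Ax.
rewrite map_submx => /submxP[z /(congr1 trmx)]; rewrite trmxK trmx_mul trmxK => ->.
rewrite map_mxM mulmxA yA -map_mxM mxE; by exists ((c *m z^T) 0 0).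
Qed.

Lemma sum_enum_val (V : nmodType) (I : finType) (f : I -> V) :
  \sum_x f x = \sum_(i < #|I|) f (enum_val i).
Proof. exact: (reindex _ (onW_bij _ (@enum_val_bij I))). Qed.

(* The inequality would not always be strict with a rational number, say 2, in
   place of [expR 1]. *)
Lemma markov_irrational (R : realType) (Omega I : finType) (k : I)
    (mu : Omega -> R) (F : I -> R) (S : Omega -> {set I}) (w : nat) (eps : R) :
  (forall o, 0 <= mu o) -> (forall j, 0 <= F j) -> 0 < \sum_j F j ->
  (forall o, k \notin S o) ->
  (forall j, j != k -> \sum_(o | j \in S o) mu o = w%:R^-1) ->
  0 < eps -> (0 < w)%N -> expR 1 / (2 * eps) <= w%:R ->
  \sum_(o | 2 * (eps * \sum_j F j) <= \sum_(j in S o) F j) mu o < (expR 1)^-1.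
Proof.
move=> mu0 F0 C0 kS Sw eps0 w0 hw.
set C := \sum_j F j in C0 *; set a := 2 * (eps * C).
pose X o := \sum_(j in S o) F j.
pose B o := a <= X o.
have e0 : 0 < expR 1 :> R := expR_gt0 1.
have wR : 0 < w%:R :> R by rewrite ltr0n.
have X0 o : 0 <= X o by apply: sumr_ge0.
have EX : \sum_o mu o * X o = (C - F k) / w%:R.
  under eq_bigr do rewrite /X mulr_sumr.
  rewrite (exchange_big_dep xpredT)//= (bigD1 k)//= big_pred0 ?add0r; last first.
    by move=> o; rewrite (negbTE (kS o)).
  rewrite /C [X in X - _](bigD1 k)//= addrAC subrr add0r mulr_suml; apply: eq_bigr => j jk.
  by rewrite -mulr_suml Sw// mulrC.
(* Suppose that [p] is at least 1/e. Then [p * a] is at most the mean of [X], which is at most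
   [C / w], then [a / e], then [p * a] again. *)
rewrite ltNge; apply/negP => pB; set p := \sum_(o | _) _ in pB.
have a0 : 0 < a by rewrite !mulr_gt0.
have aw : C / w%:R <= a / expR 1.
  rewrite ler_pdivrMr// mulrAC ler_pdivlMr//.
  move: hw; rewrite ler_pdivrMr ?mulr_gt0// => /(ler_wpM2l (ltW C0)).
  by rewrite (_ : C * (w%:R * _) = a * w%:R)//; rewrite /a; ring.
have Hge o : 0 <= mu o * X o - (B o)%:R * (mu o * a).
  rewrite /a; case BE: (B o); last by rewrite mul0r subr0 mulr_ge0.
  by rewrite mul1r subr_ge0 ler_wpM2l.
have pE : \sum_o (B o)%:R * (mu o * a) = p * a.
  rewrite /p mulr_suml [in RHS]big_mkcond/=; apply: eq_bigr => o _.
  by rewrite -/(X o) -/(B o); case: (B o); rewrite ?mul1r ?mul0r.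
have sumE : \sum_o (mu o * X o - (B o)%:R * (mu o * a)) = (C - F k) / w%:R - p * a.
  by rewrite big_split/= sumrN EX pE.
have hC : (C - F k) / w%:R <= C / w%:R.
  by rewrite ler_pM2r ?invr_gt0// gerBl.
have hp : a / expR 1 <= p * a by rewrite mulrC ler_pM2r.
(* From here on, equality holds in Markov's inequality. *)
have sum0 : \sum_o (mu o * X o - (B o)%:R * (mu o * a)) = 0.
  by apply/le_anti/andP; split; [rewrite sumE; lra|exact: sumr_ge0].
have Hz o : mu o * X o = (B o)%:R * (mu o * a).
  by apply/eqP; rewrite -subr_eq0; apply/eqP; apply: (psumr_eq0P _ sum0).
have pe : p = (expR 1)^-1.
  apply/(mulIf (lt0r_neq0 a0))/le_anti.
  by rewrite [_^-1 * _]mulrC hp andbT; rewrite sumE in sum0; lra.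
(* By [Hz], [b] selects outcomes with [X o = a]. If [F j] is positive, a collision of [j] makes
   [X o] positive, which forces [B o] unless [mu o] is 0. Items with [F j = 0] may also collide
   outside [B]; their columns are cleared, which is harmless as [F j / a] is 0. *)
pose b o := B o && (mu o != 0).
pose A : 'M[rat]_(#|Omega|, #|I|) := \matrix_(i, j)
  [&& b (enum_val i), enum_val j \in S (enum_val i) & F (enum_val j) != 0]%:R.
have := @rational_pairing R _ _ A (\col_i (b (enum_val i))%:R)
  (\row_j (((enum_val j != k) && (F (enum_val j) != 0))%:R / w%:R))
  (\row_i mu (enum_val i)) (\col_j (F (enum_val j) / a)).
case.
- apply/matrixP => i i'; rewrite !mxE ratr_nat.
  under eq_bigr do rewrite !mxE ratr_nat.
  move: (enum_val i) => o.
  rewrite -(sum_enum_val (fun j => [&& b o, j \in S o & F j != 0]%:R * (F j / a))).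
  have [/andP[Bo muo]|_] := boolP (b o); last by rewrite big1// => j; rewrite mul0r.
  have := Hz o; rewrite Bo mul1r => /(mulfI muo) <-.
  rewrite -[RHS](@mulfV _ (X o)) ?gt_eqF//; last exact: lt_le_trans Bo.
  rewrite {2}/X mulr_suml [in RHS]big_mkcond/=.
  apply: eq_bigr => j _; case: (j \in S o) => /=; last by rewrite mul0r.
  by case: eqP => [->|_]; rewrite ?mul0r ?mulr0// mul1r.
- apply/matrixP => i' i; rewrite !mxE.
  under eq_bigr do rewrite !mxE ratr_nat.
  move: (enum_val i) => j.
  rewrite -(sum_enum_val (fun o => mu o * [&& b o, j \in S o & F j != 0]%:R)).
  rewrite fmorph_div/= !ratr_nat.
  have [->|jk]/= := eqVneq j k.
    by rewrite mul0r big1// => o; rewrite (negbTE (kS o)) andbF mulr0.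
  have [Fj|Fj] := eqVneq (F j) 0.
    by rewrite mul0r big1// => o; rewrite !andbF mulr0.
  rewrite mul1r -(Sw _ jk) [in RHS]big_mkcond/=; apply: eq_bigr => o _.
  rewrite andbT; case: ifPn => [jS|]; last by rewrite andbF mulr0.
  rewrite andbT /b.
  have [->|muo] := eqVneq (mu o) 0; first by rewrite mul0r.
  case BE: (B o); first by rewrite mulr1.
  have := Hz o; rewrite BE mul0r => /eqP; rewrite mulf_eq0 (negbTE muo)/=.
  rewrite gt_eqF// /X (bigD1 j)//= ltr_wpDr ?sumr_ge0// lt0r Fj F0//.
- move=> q _; rewrite mxE.
  under [RHS]eq_bigr do rewrite !mxE ratr_nat.
  rewrite -(sum_enum_val (fun o => mu o * (b o)%:R)).
  have -> : \sum_o mu o * (b o)%:R = p.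
    rewrite /p [RHS]big_mkcond/=; apply: eq_bigr => o _.
    rewrite -/(X o) -/(B o) /b; case: (B o); rewrite ?mulr0//=.
    by case: eqP => [->|]; rewrite ?mulr1 ?mul0r.
  rewrite pe => qe; apply: (@irrational_expR1 R); exists q^-1 => //.
  by rewrite fmorphV/= qe invrK.
Qed.

(** * Deterministic error of a Space Saving cell *)

(** Meant for [f] the true weights and [W] the weight received by the cell. The clause on free
    counters makes setting a value to [x] the same as adding [x]. *)
Definition ss_invariant (R : realType) (m : nat) (S : summary R m)
    (f : 'I_m -> R) (W : R) : Prop :=
  let: (c1, c2) := S in
  [/\ 0 <= c1.2 /\ 0 <= c2.2, c1.2 + c2.2 = W,
      (c1.1 = None -> c1.2 = 0) /\ (c2.1 = None -> c2.2 = 0),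
      forall j, c1.1 = Some j -> c1.2 - f j <= c2.2 &
      forall j, c2.1 = Some j -> c2.2 - f j <= c1.2].

(** On eviction, the new value exceeds the weight of [i], at least [x], by at most the old value,
    which the other counter dominates, however ties are broken. Inequalities between [f] and [f']
    suffice, as a larger weight only lowers the excess. *)
Lemma ss_invariant_update (R : realType) (m : nat) (tie : summary R m -> bool)
    (S : summary R m) (f f' : 'I_m -> R) (W : R) (i : 'I_m) (x : R) :
  (forall j, 0 <= f j) -> 0 <= x -> (forall j, f j <= f' j) -> f i + x <= f' i ->
  ss_invariant S f W -> ss_invariant (ss_update tie S i x) f' (W + x).
Proof.
move: S => [[i1 a1] [i2 a2]] f0 x0 ff' fi [/= [a10 a20] <- [n1 n2] m1 m2].
have m1' j : i1 = Some j -> a1 - f' j <= a2.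
  by move=> /m1; move: (ff' j); lra.
have m2' j : i2 = Some j -> a2 - f' j <= a1.
  by move=> /m2; move: (ff' j); lra.
have fi0 := f0 i.
have none1 (y : R) : Some i = None -> y = 0 by [].
have Some_inj j : Some i = Some j -> i = j by case.
case: ifPn => [/eqP e1|_].
  have := m1 _ e1; split=> /=; [lra|lra|by split|move=> j /Some_inj<-; lra|].
  by move=> j /m2'; lra.
case: ifPn => [/eqP e2|_].
  have := m2 _ e2; split=> /=; [lra|lra|by split|by move=> j /m1'; lra|].
  by move=> j /Some_inj<-; lra.
case: ifPn => [/eqP/n1 e1|_].
  split=> /=; [lra|lra|by split|move=> j /Some_inj<-; lra|].
  by move=> j /m2'; lra.
case: ifPn => [/eqP/n2 e2|_].
  split=> /=; [lra|lra|by split|by move=> j /m1'; lra|].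
  by move=> j /Some_inj<-; lra.
case: ifPn => [lt12|].
  have {lt12} le12 : a1 <= a2.
    by case/orP: lt12 => [/ltW//|/andP[/eqP-> _]].
  split=> /=; [lra|lra|by split|move=> j /Some_inj<-; lra|].
  by move=> j /m2'; lra.
rewrite negb_or -leNgt => /andP[/= le21 _].
split=> /=; [lra|lra|by split|by move=> j /m1'; lra|].
by move=> j /Some_inj<-; lra.
Qed.

(** If [k] is monitored, its excess is at most the other counter, which is [W] minus the value
    returned. Otherwise the minimum is at most half of [W]. *)
Lemma ss_query_error (R : realType) (m : nat) (S : summary R m)
    (f : 'I_m -> R) (W : R) (k : 'I_m) :
  0 <= f k -> ss_invariant S f W -> 2 * (ss_query S k - f k) <= W - f k.
Proof.
move: S => [[i1 a1] [i2 a2]] f0 [/= [a10 a20] <- _ m1 m2].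
case: ifPn => [/eqP/m1|_]; first by lra.
case: ifPn => [/eqP/m2|_]; first by lra.
have : Num.min a1 a2 <= a1 by rewrite ge_min lexx.
have : Num.min a1 a2 <= a2 by rewrite ge_min lexx orbT.
by move: (Num.min _ _) => q /=; lra.
Qed.

Definition item_weight (R : realType) (m : nat) (g : R -> R) (L : R)
    (sigma : seq ('I_m * R)) (j : 'I_m) : R :=
  \sum_(e <- sigma | e.1 == j) g (e.2 - L).

(** The weights are those in the whole stream, so the items reaching the cell need not be tracked:
    updates elsewhere only increase the weights, which preserves the invariant. *)
Lemma fdcmss_invariant (R : realType) (m d w : nat)
    (tie : summary R m -> bool) (g : R -> R) (L : R)
    (h : 'I_d -> {ffun 'I_m -> 'I_w})
    (sigma : seq ('I_m * R)) (r : 'I_d)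
    (c : 'I_w) :
  (forall e, e \in sigma -> 0 <= g (e.2 - L)) ->
  ss_invariant (fdcmss tie g L h sigma r c) (item_weight g L sigma)
    (\sum_(e <- sigma | h r e.1 == c) g (e.2 - L)).
Proof.
rewrite /item_weight.
elim/last_ind: sigma => [_|s e IH g0].
  by rewrite /fdcmss/= mxE big_nil; split=> //=; rewrite addr0.
have gs e' : e' \in s -> 0 <= g (e'.2 - L).
  by move=> e's; apply: g0; rewrite mem_rcons inE e's orbT.
have ge : 0 <= g (e.2 - L) by apply: g0; rewrite mem_rcons inE eqxx.
have {}IH := IH gs.
rewrite /fdcmss foldl_rcons/= mxE -/(fdcmss _ _ _ _ _) big_rcons/=.
have f0 j : 0 <= \sum_(e <- s | e.1 == j) g (e.2 - L).
  by rewrite big_seq_cond; apply: sumr_ge0 => e' /andP[/gs].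
have mono j : \sum_(e <- s | e.1 == j) g (e.2 - L) <=
    \sum_(e <- rcons s e | e.1 == j) g (e.2 - L).
  by rewrite big_rcons/= lerDl; case: ifP.
rewrite [h r e.1 == c]eq_sym; case: eqP => _.
  apply: ss_invariant_update IH => //.
  by rewrite big_rcons/= eqxx.
rewrite addr0; move: (fdcmss _ _ _ _ _ _ _) IH => [c1 c2] [p1 p2 p3 m1 m2].
split=> // j jj.
  by apply: le_trans (m1 _ jj); rewrite lerB.
by apply: le_trans (m2 _ jj); rewrite lerB.
Qed.

Lemma fdcmss_row_error (R : realType) (m d w : nat)
    (tie : summary R m -> bool) (g : R -> R) (L : R)
    (h : 'I_d -> {ffun 'I_m -> 'I_w})
    (sigma : seq ('I_m * R)) (r : 'I_d)
    (k : 'I_m) :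
  (forall e, e \in sigma -> 0 <= g (e.2 - L)) ->
  2 * (ss_query (fdcmss tie g L h sigma r (h r k)) k - item_weight g L sigma k) <=
  \sum_(j in [set j | (j != k) && (h r j == h r k)]%SET) item_weight g L sigma j.
Proof.
move=> g0.
have fk0 : 0 <= item_weight g L sigma k.
  by rewrite /item_weight big_seq_cond; apply: sumr_ge0 => e /andP[/g0].
apply: le_trans (ss_query_error fk0 (fdcmss_invariant tie h r (h r k) g0)) _.
rewrite lerBlDl.
(* The weight of the cell is regrouped by item; the term of [k] then cancels. *)
have -> : \sum_(e <- sigma | h r e.1 == h r k) g (e.2 - L) =
    \sum_(j | h r j == h r k) item_weight g L sigma j.
  rewrite /item_weight (exchange_big_dep xpredT)//= big_mkcond/=.
  apply: eq_bigr => e _.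
  case: ifPn => ek.
    rewrite (big_pred1 e.1)// => j /=; rewrite [RHS]eq_sym.
    by have [<-|] := eqVneq e.1 j; rewrite ?ek ?andbF.
  rewrite big_pred0// => j.
  by case: (eqVneq e.1 j) => [<-|]; rewrite ?andbF// (negbTE ek).
rewrite (bigD1 k)//= lerD2l le_eqVlt; apply/orP; left; apply/eqP.
by apply: eq_bigl => j; rewrite inE andbC.
Qed.

(** * Events on random hash functions *)

(** Passes from [T] to a finite set of functions, where the finite form of Markov's inequality
    applies. *)
Lemma probability_finite_preimage (R : realType) (disp : measure_display)
    (T : measurableType disp) (P : probability T R) (m w : nat)
    (h : T -> {ffun 'I_m -> 'I_w}) (b : pred {ffun 'I_m -> 'I_w}) :
  random_hash h ->
  P (h @^-1` [set` b]) = (\sum_(phi | b phi) fine (P (h @^-1` [set phi])))%:E.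
Proof.
move=> mh.
have -> : h @^-1` [set` b] = \bigcup_(phi in [set` b]) h @^-1` [set phi].
  apply/seteqP; split=> [u bu|u [phi bphi /= hu]]; first by exists (h u).
  by rewrite /= hu.
rewrite measure_fin_bigcup//; last first.
- by apply/trivIsetP => i j _ _ /eqP ij; apply/seteqP; split=> // o [/= -> ].
rewrite -(bigfs _ (index_enum_uniq _))/=; last first.
  by move=> i _; rewrite mem_index_enum.
rewrite -sumEFin.
apply: eq_bigr => phi _; rewrite fineK// fin_num_measure//; exact: mh.
Qed.

Lemma seq_min_leP (R : realType) (s : seq R) (a : R) : s != [::] ->
  reflect {in s, forall x, a <= x} (a <= seq_min s).
Proof.
case: s => // x0 s _; rewrite /seq_min/=.
apply: (iffP idP) => [ha x xs|ha].
  by apply: le_trans ha _; apply: ge_bigmin_seq.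
rewrite big_seq; apply: le_bigmin; first by apply: ha; rewrite mem_head.
by move=> i; exact: ha.
Qed.

(** Each of the [w] common values contributes [1 / w ^ 2]. *)
Lemma pairwise_collision (R : realType) (disp : measure_display)
    (T : measurableType disp) (P : probability T R) (m w : nat)
    (h : T -> {ffun 'I_m -> 'I_w}) (a b : 'I_m) :
  random_hash h -> pairwise_independent_hash P h -> a != b ->
  P (h @^-1` [set phi | phi a = phi b]) = (w%:R^-1)%:E.
Proof.
move=> mh [h1 h2] ab.
have -> : h @^-1` [set phi | phi a = phi b] =
   \bigcup_(x in [set: 'I_w]) [set o | h o a = x /\ h o b = x].
  apply/seteqP; split=> [u /= E|o [x _ /= [-> ->]]//]; by exists (h u a).
rewrite measure_fin_bigcup//; last 3 first.
- exact: finite_finset.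
- apply/trivIsetP => i j _ _ /eqP ij; apply/seteqP.
  by split=> // o [/= [-> _] [+ _]].
- move=> x _; exact: (mh [set phi | phi a = x /\ phi b = x]).
have E x : P [set o | h o a = x /\ h o b = x] = (w%:R^-1 * w%:R^-1)%:E.
  by rewrite h2// !h1 EFinM.
rewrite (_ : [set: 'I_w] = [set` predT]); last by apply/seteqP; split.
rewrite -(bigfs _ (index_enum_uniq _))/=; last first.
  by move=> i _; rewrite mem_index_enum.
rewrite (eq_bigr _ (fun x _ => E x)) sumEFin sumr_const card_ord.
(* For [w = 0] the sum is empty and [0^-1] is 0. *)
have [->|w0] := eqVneq w 0%N; first by rewrite mulr0n invr0.
by congr EFin; rewrite -[LHS]mulr_natr mulfVK ?pnatr_eq0.
Qed.

(** Makes the failure of row [r] an event on [h r] alone, as independence of the rows requires. *)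
Lemma fdcmss_row_local (R : realType) (m d w : nat) (tie : summary R m -> bool)
    (g : R -> R) (L : R) (h h' : 'I_d -> {ffun 'I_m -> 'I_w})
    (sigma : seq ('I_m * R)) (r : 'I_d) :
  h r = h' r -> fdcmss tie g L h sigma r =1 fdcmss tie g L h' sigma r.
Proof.
move=> hr c; elim/last_ind: sigma => [|s e IH]; first by rewrite /fdcmss !mxE.
by rewrite /fdcmss !foldl_rcons !mxE -!/(fdcmss _ _ _ _ _) IH hr.
Qed.

(** * Combination of the rows *)

Theorem theorem1 (R : realType) (eps delta : R)
  (heps : 0 < eps < 1) (hdelta : 0 < delta < 1)
  (d w : nat)
  (hd : d%:Z = Num.ceil (ln (1 / delta)))
  (hw : w%:Z = Num.ceil (expR 1 / (2 * eps)))
  (g : R -> R)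
  (gpos : forall x : R, 0 < x -> 0 < g x)
  (gmono : forall x y : R, 0 < x -> x <= y -> g x <= g y)
  (m : nat) (L t : R) (sigma : seq ('I_m * R))
  (hsigma : sigma <> [::])
  (hL : forall e : 'I_m * R, e \in sigma -> L < e.2)
  (ht : forall e : 'I_m * R, e \in sigma -> e.2 <= t)
  (tie : summary R m -> bool)
  (disp : measure_display) (T : measurableType disp) (P : probability T R)
  (h : 'I_d -> T -> {ffun 'I_m -> 'I_w})
  (hmeas : forall r : 'I_d, random_hash (h r))
  (hpair : forall r : 'I_d, pairwise_independent_hash P (h r))
  (hindep : mutually_independent P h)
  (k : 'I_m) :
  ((1 - delta)%:E <
    P [set o : T |
        (point_query g L t (h^~ o) (fdcmss tie g L (h^~ o) sigma) k
         - decayed_count g L t sigma k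
         < eps * total_decayed_count g L t sigma)%R])%E.

Proof.
have [eps0 _] := andP heps; have [delta0 delta1] := andP hdelta.
have e0 : 0 < expR 1 :> R := expR_gt0 1.
pose G := g (t - L).
have ge e : e \in sigma -> 0 < g (e.2 - L).
  by move=> /hL es; rewrite gpos// subr_gt0.
have gw e : e \in sigma -> 0 <= g (e.2 - L) by move=> /ge/ltW.
have [e0s e0sigma] : exists e, e \in sigma.
  by case: (sigma) hsigma => // e s _; exists e; rewrite mem_head.
have G0 : 0 < G.
  by rewrite gpos// subr_gt0 (lt_le_trans (hL _ e0sigma) (ht _ e0sigma)).
have wR : expR 1 / (2 * eps) <= w%:R.
  by have := ceil_ge (expR 1 / (2 * eps)); rewrite -hw.
have w0 : (0 < w)%N.
  by rewrite -(ltr0n R) (lt_le_trans _ wR)// divr_gt0// mulr_gt0.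
have dR : ln (1 / delta) <= d%:R.
  by have := ceil_ge (ln (1 / delta)); rewrite -hd.
have d0 : (0 < d)%N.
  by rewrite -(ltr0n R) (lt_le_trans _ dR)// ln_gt0// div1r invf_gt1.
pose F := item_weight g L sigma.
have F0 j : 0 <= F j.
  by rewrite /F /item_weight big_seq_cond; apply: sumr_ge0 => e /andP[/gw].
have FE : \sum_j F j = \sum_(e <- sigma) g (e.2 - L).
  rewrite /F /item_weight (exchange_big_dep xpredT)//=; apply: eq_bigr => e _.
  by rewrite (big_pred1 e.1)// => j /=; rewrite eq_sym.
set C := \sum_j F j in FE.
have C0 : 0 < C.
  rewrite FE (big_rem e0s)//= ltr_wpDr ?ge// big_seq; apply: sumr_ge0 => e.
  by move=> /mem_rem; exact: gw.
(* All rows are given the same [phi], so that [A r] is a set of single functions; row locality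
   relates this to the actual sketch. *)
pose cell (phi : {ffun 'I_m -> 'I_w}) (r : 'I_d) : R :=
  ss_query (fdcmss tie g L (fun _ : 'I_d => phi) sigma r (phi k)) k.
pose A (r : 'I_d) := [set phi | eps * C <= cell phi r - F k].
(* A minimum is too large exactly when every row is; the factor [1 / G] cancels. *)
have failE : ~` [set o : T |
    point_query g L t (h^~ o) (fdcmss tie g L (h^~ o) sigma) k
    - decayed_count g L t sigma k < eps * total_decayed_count g L t sigma]
  = \bigcap_(r in [set: 'I_d]) (h r @^-1` A r).
  have queryP u (a : R) : reflect (forall r, a <= cell (h r u) r)
      (a <= seq_min [seq ss_query (fdcmss tie g L (h^~ u) sigma r (h r u k)) k
                    | r <- enum 'I_d]).
    have -> : [seq ss_query (fdcmss tie g L (h^~ u) sigma r (h r u k)) k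
        | r <- enum 'I_d] = [seq cell (h r u) r | r <- enum 'I_d].
      by apply: eq_map => r; congr (ss_query _ k); exact: fdcmss_row_local.
    apply: (iffP (seq_min_leP _ _)).
    - by rewrite -size_eq0 size_map size_enum_ord -lt0n.
    - by move=> ha r; apply: ha; apply: map_f; rewrite mem_enum.
    - by move=> ha _ /mapP[r _ ->].
  have scaleE q : (q / G - decayed_count g L t sigma k
      < eps * total_decayed_count g L t sigma) = (q - F k < eps * C).
    rewrite /decayed_count /total_decayed_count -!mulr_suml.
    rewrite -/(item_weight g L sigma k) -/F -FE -/G.
    by rewrite mulrA -mulrBl ltr_pM2r// invr_gt0.
  apply/seteqP; split=> u /=.
  - rewrite /point_query scaleE => /negP.
    rewrite -leNgt lerBrDr => /queryP qa r _.
    by rewrite /A/= lerBrDr.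
  - move=> uA; rewrite /point_query scaleE; apply/negP; rewrite -leNgt lerBrDr.
    by apply/queryP => r; have := uA r I; rewrite /A/= lerBrDr.
have pA r : (P (h r @^-1` A r) < ((expR 1)^-1)%R%:E)%E.
  pose S (phi : {ffun 'I_m -> 'I_w}) := [set j | (j != k) && (phi j == phi k)]%SET.
  (* The factor 2 reflects that a two-counter cell errs by at most half of the colliding weight. *)
  pose b phi := 2 * (eps * C) <= \sum_(j in S phi) F j.
  apply: (@le_lt_trans _ _ (P (h r @^-1` [set` b]))).
    apply: le_measure; rewrite ?inE; [exact: hmeas|exact: hmeas|].
    move=> u /= Au; rewrite /b.
    have := fdcmss_row_error tie (fun _ : 'I_d => h r u) r k gw.
    by move: Au; rewrite /A /cell/= => Au; apply: le_trans; rewrite ler_pM2l.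
  rewrite probability_finite_preimage; last exact: hmeas.
  rewrite lte_fin.
  apply: (@markov_irrational R _ _ k _ F S w eps) => //.
  - by move=> phi; rewrite fine_ge0.
  - by move=> phi; rewrite inE eqxx.
  - move=> j jk; apply: EFin_inj.
    rewrite -(pairwise_collision (hmeas r) (hpair r) jk).
    rewrite -probability_finite_preimage; last exact: hmeas.
    congr (P _); apply/seteqP; split=> u /=.
      by rewrite unfold_in /= inE jk => /eqP.
    by move=> hjk; rewrite unfold_in /= inE jk hjk eqxx.
have mA : measurable (\bigcap_(r in [set: 'I_d]) (h r @^-1` A r)).
  apply: fin_bigcap_measurable => [|r _]; [exact: finite_finset|exact: hmeas].
rewrite -[X in P X]setCK failE probability_setC//.
rewrite hindep.
have pE r : P (h r @^-1` A r) = (fine (P (h r @^-1` A r)))%:E.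
  by rewrite fineK// fin_num_measure//; exact: hmeas.
under eq_bigr do rewrite pE.
rewrite prodEFin -EFinB lte_fin ltrD2l ltrN2.
apply: (@lt_le_trans _ _ (\prod_(r < d) (expR 1)^-1)).
  (* Strictness needs a nonempty product: [0 < d] since [delta < 1]. *)
  apply: ltr_prod => [|r _].
    by apply/hasP; exists (Ordinal d0) => //; rewrite mem_index_enum.
  by rewrite fine_ge0//= -lte_fin -pE.
rewrite prodr_const card_ord exprVn -expRM_natl mulr1.
rewrite -[leRHS]invrK lef_pV2 ?posrE ?invr_gt0 ?expR_gt0//.
by rewrite -(ler_expR) lnK ?posrE ?divr_gt0// div1r in dR.
Qed.
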